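(* Let $F$ be a field of positive characteristic $p$, and let $(V,+)$ be a finite-dimensional vector space over $F$. Then every abelian regular subgroup of $\mathrm{Aff}(V)$ has finite exponent, which is a power of $p$.
   Context: $\mathrm{Aff}(V)$ is the affine group on $V$: the group of permutations of $V$ generated by the group $\mathrm{GL}(V)$ of invertible $F$-linear maps on $V$ and the group of translations $z \mapsto z + x$ ($x \in V$). A group $G$ of permutations on a set $\Omega$ is regular if, given any $\alpha \in \Omega$, for each $\beta \in \Omega$ there exists a unique $g \in G$ mapping $\alpha$ to $\beta$. *)

(* Defs.v *)
From HB Require Import structures.
From mathcomp Require Import all_boot all_order all_algebra.
From mathcomp Require Import boolp.

Set Implicit Arguments.
Unset Strict Implicit.
Unset Printing Implicit Defensive.

Import GRing.Theory.

(* Permutations of an arbitrary, possibly infinite, type. [{perm T}] requires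
   [T] to be finite, so it cannot be used for a vector space over an infinite
   field. The inverse is stored, but [permutation_ext] shows that a permutation
   is determined by its underlying function. *)
Record permutation (T : Type) := Permutation {
  pfun :> T -> T;
  pinv : T -> T;
  pfunK : cancel pfun pinv;
  pinvK : cancel pinv pfun
}.

HB.instance Definition _ (T : Type) := gen_eqMixin (permutation T).
HB.instance Definition _ (T : Type) := gen_choiceMixin (permutation T).

Section PermutationGroup.
Variable T : Type.
Implicit Types g h k : permutation T.

Lemma permutation_ext g h : g =1 h -> g = h.
Proof.
case: g h => [f f' fK f'K] [u u' uK u'K] /= e.
have eu : f = u by apply/funext.
subst u; have e' : f' = u' by apply/funext => x; rewrite -{1}(u'K x) fK.
subst u'; congr Permutation; exact: Prop_irrelevance.
Qed.

Definition permutation_one : permutation T :=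
  @Permutation T id id (fun=> erefl) (fun=> erefl).

Definition permutation_inv g : permutation T := Permutation (pinvK g) (pfunK g).

(* Same convention as for [{perm T}]: [g * h] applies [g] first. *)
Definition permutation_mul g h : permutation T :=
  Permutation (can_comp (pfunK h) (pfunK g)) (can_comp (pinvK g) (pinvK h)).

Lemma permutation_mulA : associative permutation_mul.
Proof. by move=> g h k; apply: permutation_ext. Qed.

Lemma permutation_mul1g : left_id permutation_one permutation_mul.
Proof. by move=> g; apply: permutation_ext. Qed.

Lemma permutation_mulg1 : right_id permutation_one permutation_mul.
Proof. by move=> g; apply: permutation_ext. Qed.

Lemma permutation_mulVg :
  left_inverse permutation_one permutation_inv permutation_mul.
Proof. by move=> g; apply: permutation_ext => x /=; rewrite pinvK. Qed.

Lemma permutation_mulgV :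
  right_inverse permutation_one permutation_inv permutation_mul.
Proof. by move=> g; apply: permutation_ext => x /=; rewrite pfunK. Qed.

HB.instance Definition _ := isGroup.Build (permutation T)
  permutation_mulA permutation_mul1g permutation_mulg1
  permutation_mulVg permutation_mulgV.

End PermutationGroup.

(* Subgroups are the library's [groupClosed] boolean predicates; classically,
   this loses nothing with respect to Prop-valued subgroups. *)
Lemma groupClosed_of_Prop (gT : groupType) (P : gT -> Prop) :
  P 1%g -> (forall x y, P x -> P y -> P (x * y)%g) ->
  (forall x, P x -> P (x^-1)%g) ->
  exists H : groupClosed gT, forall x, x \in H <-> P x.
Proof.
move=> P1 PM PV; pose S : {pred gT} := fun x => `[< P x >].
have SM : mulg_closed S.
  by move=> x y /asboolP Px /asboolP Py; apply/asboolP; apply: PM.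
have SV : invg_closed S by move=> x /asboolP Px; apply/asboolP; apply: PV.
have S1 : 1%g \in S by apply/asboolP.
pose H : groupClosed gT := HB.pack S (isMulClosed.Build gT S SM)
  (isMul1Closed.Build gT S S1) (isInvClosed.Build gT S SV).
by exists H => x; split=> [/asboolP//|Px]; apply/asboolP.
Qed.

Definition generated (gT : groupType) (S : gT -> Prop) (x : gT) : Prop :=
  forall H : groupClosed gT, (forall y, S y -> y \in H) -> x \in H.

Definition abelian_subgroup (gT : groupType) (G : groupClosed gT) : Prop :=
  {in G &, forall x y, commute x y}.

Definition regular_subgroup (T : Type) (G : groupClosed (permutation T)) :
    Prop :=
  forall a b : T, exists! g : permutation T, g \in G /\ g a = b.

(* [n] is the (finite) exponent of [G]; for infinite [G] it may fail to exist,
   hence a relation rather than a function. *)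
Definition is_exponent (gT : groupType) (G : groupClosed gT) (n : nat) : Prop :=
  [/\ 0 < n,
      {in G, forall x, (x ^+ n)%g = 1%g} &
      forall m, 0 < m -> {in G, forall x, (x ^+ m)%g = 1%g} -> n <= m].

Section AffineGroup.
Variables (F : fieldType) (V : vectType F).
Local Open Scope ring_scope.

Definition in_GL (g : permutation V) : Prop := linear g.

Definition is_translation (g : permutation V) : Prop :=
  exists x : V, forall z : V, g z = z + x.

Definition in_Aff : permutation V -> Prop :=
  generated (fun g => in_GL g \/ is_translation g).

End AffineGroup.

(* Main.v *)
From HB Require Import structures.
Require Import Defs.
From mathcomp Require Import all_boot all_order all_algebra.
From mathcomp Require Import boolp.

(** Let [t x] be the element of [G] that maps 0 to [x], and write
    [t x z = x + z + x . z] with [x . z] linear in [z]. Commutativity of [G]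
    says [x . y = y . x], so the product is bilinear, and closure of [G] under
    composition then says that it is associative. So [V] is a commutative
    algebra, without unit, on which [G] is the group of the circle operation
    [x + y + x . y] (this is the correspondence of Caranti, Dalla Volta and
    Sala between abelian regular subgroups and commutative radical algebras).

    Since every [t y] is injective, [y . w = w] forces [w = 0]
    ([abelian_regular_algebra]). In dimension [n] this makes the algebra nil:
    among the [n + 1] powers [x, x^2, ..., x^(n+1)] some power [w] is a
    combination of later ones, so [w = y . w] for some [y], and [w = 0]
    ([iter_mul_nilpotent]).

    Finally the binomial formula (1 + x)^m - 1 reads
    [t x ^ m : 0 |-> \sum_(1 <= i <= m) 'C(m, i) x^i] ([iter_affine_binomial]);
    for [m = p ^ n] only [x ^ (p ^ n)] survives modulo [p], and it is zero since
    [n < p ^ n]. By regularity [t x ^ (p ^ n) = 1]. *)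

Set Implicit Arguments.
Unset Strict Implicit.
Unset Printing Implicit Defensive.

Import GRing.Theory.

(** The least positive [m] that kills [G] divides [p ^ n], as the remainder of
    [p ^ n] modulo [m] also kills [G]. *)
Lemma is_exponent_pfactor (gT : groupType) (G : groupClosed gT) (p n : nat) :
  prime p -> {in G, forall x, (x ^+ (p ^ n))%g = 1%g} ->
  exists k, is_exponent G (p ^ k).
Proof.
move=> pr_p kills.
pose P m := (0 < m) && `[< {in G, forall x, (x ^+ m)%g = 1%g} >].
have exP : exists m, P m.
  by exists (p ^ n); rewrite /P expn_gt0 prime_gt0 //=; apply/asboolP.
case: (ex_minnP exP) => m /andP[m_gt0 /asboolP mK] m_min.
have /(dvdn_pfactor _ _ pr_p)[k _ Dm] : m %| p ^ n.
  rewrite /dvdn eqn0Ngt; apply/negP => r_gt0.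
  have /m_min : P (p ^ n %% m).
    rewrite /P r_gt0; apply/asboolP => x Gx.
    by rewrite -[RHS](kills x Gx) {2}(divn_eq (p ^ n) m) expgnDr mulnC expgnA
               mK // expg1n mul1g.
  by rewrite leqNgt ltn_mod m_gt0.
exists k; rewrite -Dm; split=> // q q_gt0 qK.
by apply: m_min; rewrite /P q_gt0; apply/asboolP.
Qed.

(** From [i.+1 * 'C(p ^ k, i.+1) = p ^ k * 'C((p ^ k).-1, i)]: were the
    binomial prime to [p], [p ^ k] would divide [i.+1]. *)
Lemma prime_power_dvd_bin (p k i : nat) :
  prime p -> i.+1 < p ^ k -> p %| 'C(p ^ k, i.+1).
Proof.
move=> pr_p lt_i; apply: contraLR lt_i; rewrite -prime_coprime // -leqNgt => co.
apply: dvdn_leq => //.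
rewrite -(Gauss_dvdl _ (coprimeXl k co)) -mul_bin_diag.
exact: dvdn_mulr.
Qed.

Local Open Scope ring_scope.

(** [f^i x] plays the part of [x^(i+1)] in the binomial formula for
    (1 + x)^m - 1; the iterated map is [z |-> (1 + x) (1 + z) - 1]. *)
Lemma iter_affine_binomial (V : zmodType) (f : {additive V -> V}) (x : V) m :
  iter m (fun z => x + z + f z) 0 =
  \sum_(i < m) iter i f x *+ 'C(m, i.+1).
Proof.
elim: m => [|m IHm]; first by rewrite big_ord0.
rewrite iterS IHm.
under [RHS]eq_bigr => i _ do rewrite binS mulrnDr.
rewrite big_split /= big_ord_recr /= bin_small // mulr0n addr0.
rewrite big_ord_recl /= bin0 mulr1n raddf_sum addrA [x + _]addrC.
by congr (_ + _); apply: eq_bigr => i _; rewrite raddfMn.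
Qed.

Section NilAlgebra.
Variables (F : fieldType) (V : vectType F) (mul : V -> V -> V).
Hypothesis mulA : associative mul.
Hypothesis mul_linear_l : forall y, linear (mul^~ y).
Hypothesis mul_linear_r : forall x, linear (mul x).

Lemma iter_mulD x i j :
  mul (iter i (mul x) x) (iter j (mul x) x) = iter (i + j).+1 (mul x) x.
Proof. by elim: i => //= i IHi; rewrite -mulA IHi. Qed.

(** The hypothesis is the cancellation of [1 - y] for every [y], i.e. that the
    algebra is radical. It yields a power of [x] that is zero because a linear
    dependence between powers, divided by its lowest term [w], reads
    [w = mul y w]. *)
Lemma iter_mul_nilpotent :
  (forall y w, mul y w = w -> w = 0) ->
  forall x n, (\dim {: V} <= n)%N -> iter n (mul x) x = 0.
Proof.
move=> fixed_eq0 x n le_n; pose X := [tuple iter i (mul x) x | i < n.+1].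
have mulr0 z : mul z 0 = 0.
  by have /(congr1 (+%R^~ (- mul z 0))) := mul_linear_r z 1 0 0;
     rewrite !scale1r addr0 addrK subrr.
have XE j : (j < n.+1)%N -> X`_j = iter j (mul x) x.
  by move=> lt_j; rewrite -(tnth_nth 0 X (Ordinal lt_j)) tnth_mktuple.
have : ~~ free X.
  apply/negP; rewrite /free size_tuple => /eqP dimX.
  by have := dimvS (subvf <<X>>%VS); rewrite dimX leqNgt ltnS le_n.
rewrite freeNE => /existsP[i]; set w := X`_i => w_span.
have wE : w = iter i (mul x) x by apply: XE.
pose mulw : {linear V -> V} := HB.pack (mul^~ w)
  (GRing.isLinear.Build F V V *:%R (mul^~ w) (mul_linear_l w)).
have w0 : w = 0.
  have /subvP/(_ w w_span) : (<<drop i.+1 X>> <= limg (linfun mulw))%VS.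
    apply/span_subvP => v /(nthP 0)[j].
    rewrite size_drop size_tuple nth_drop => lt_j <-.
    rewrite XE; last by rewrite -ltn_subRL.
    have -> : iter (i.+1 + j) (mul x) x = linfun mulw (iter j (mul x) x).
      by rewrite lfunE /= wE iter_mulD addnC.
    exact/memv_img/memvf.
  by case/memv_imgP => y _; rewrite lfunE => /esym/fixed_eq0.
have le_in : (i <= n)%N by rewrite -ltnS.
rewrite -(subnK le_in) iterD -wE w0.
by elim: (n - i)%N => //= m ->.
Qed.

End NilAlgebra.

Section AffinePermutations.
Variables (F : fieldType) (V : vectType F).

Definition affine (g : permutation V) :=
  exists f : {linear V -> V}, forall z, g z = f z + g 0.

(** Affine maps form a group that contains the generators of the affine
    group; the linear part of an inverse is the inverse of the linear part. *)
Lemma in_Aff_affine g : in_Aff g -> affine g.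
Proof.
have affM g1 g2 : affine g1 -> affine g2 -> affine (g1 * g2)%g.
  move=> [f1 E1] [f2 E2]; exists (f2 \o f1) => z /=.
  by rewrite E2 E1 linearD -addrA -E2.
have aff1 : affine 1%g by exists idfun => z /=; rewrite addr0.
have affV g1 : affine g1 -> affine (g1^-1)%g.
  move=> [f E]; pose f' z := pinv g1 (z + g1 0).
  have fK : cancel f f' by move=> z; rewrite /f' -E pfunK.
  have f'K : cancel f' f.
    by move=> z; apply: (addIr (g1 0)); rewrite -E /f' pinvK.
  have f'_linear := can2_linear fK f'K.
  pose fV : {linear V -> V} :=
    HB.pack f' (GRing.isLinear.Build F V V *:%R f' f'_linear).
  exists fV => z /=.
  apply: (can_inj (pfunK g1)); rewrite pinvK E linearD -addrA -E pinvK addr0.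
  by rewrite f'K.
have [H HP] := groupClosed_of_Prop aff1 affM affV.
move=> /(_ H) gH; apply/HP/gH => {gH}g [gL|[x gx]]; apply/HP.
  pose f : {linear V -> V} :=
    HB.pack (pfun g) (GRing.isLinear.Build F V V *:%R (pfun g) gL).
  by exists f => z; rewrite -[g 0]/(f 0) linear0 addr0.
by exists idfun => z; rewrite !gx add0r.
Qed.

(** The product is [f x z = t x z - x - z], where [t x] is the element of [G]
    with value [x] at 0. It is linear in [z] because [t x] is affine, and in [x]
    because [t x] and [t y] commute. Associativity then follows from the circle
    law, and the cancellation property is the injectivity of [t (- y)]: if
    [f y w = w], this permutation sends both [w] and 0 to [- y]. *)
Lemma abelian_regular_algebra (G : groupClosed (permutation V)) :
  {in G, forall g, affine g} -> abelian_subgroup G -> regular_subgroup G ->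
  exists f : V -> {linear V -> V},
    [/\ associative (fun x => f x), forall y, linear (fun x => f x y),
        forall y w, f y w = w -> w = 0 &
        {in G, forall (g : permutation V) z, g z = g 0 + z + f (g 0) z}].
Proof.
move=> G_affine G_abelian G_regular.
have G_inj : {in G &, forall g h : permutation V, g 0 = h 0 -> g = h}.
  move=> g h Gg Gh eq0; have [k [_ k_uniq]] := G_regular 0 (h 0).
  by rewrite -(k_uniq g) // -(k_uniq h).
have /choice[t tP] x : exists g, g \in G /\ g 0 = x.
  by have [g [[]]] := G_regular 0 x; exists g.
have Gt x : t x \in G by case: (tP x).
have t0 x : t x 0 = x by case: (tP x).
have /choice[L LP] x := G_affine _ (Gt x).
have [f tE] : exists f : V -> {linear V -> V}, forall x z, t x z = x + z + f x z.
  exists (fun x => L x \- idfun) => x z /=.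
  by rewrite LP t0 [RHS]addrC [x + z]addrC addrA subrK.
have fC x y : f x y = f y x.
  have /(congr1 (fun g : permutation V => g 0)) := G_abelian _ _ (Gt y) (Gt x).
  by rewrite /= !t0 !tE [y + x]addrC => /addrI.
have f_linear_l y : linear (fun x => f x y).
  by move=> a u v; rewrite !(fC _ y) linearP.
have fD u v z : f (u + v) z = f u z + f v z.
  by have := f_linear_l z 1 u v; rewrite !scale1r.
(* Composing with [t y] first and [t x] next maps 0 to [x + y + x . y]. *)
have tM x y : t (x + y + f x y) = (t y * t x)%g.
  by apply: G_inj => //; rewrite ?gpredM //= !t0 tE.
exists f; split=> //.
- move=> x y z; have := congr1 (fun g : permutation V => g z) (tM x y).
  rewrite /= !tE !fD !linearD [LHS](AC (4*3) ((1*2*3*4*5*6)*7)) /=.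
  by rewrite [RHS](AC ((1*3)*3) ((1*2*5*3*6*4)*7)) => /addrI/esym.
- move=> y w fix_w; apply: (can_inj (pfunK (t (- y)))).
  have fN : f (- y) w = - f y w.
    have f0 : f 0 w = 0 by apply: (addIr (f 0 w)); rewrite -fD !add0r.
    by apply: (addIr (f y w)); rewrite -fD !addNr.
  by rewrite t0 tE fN fix_w addrK.
- by move=> g Gg z; rewrite -tE; congr (pfun _ z); apply: G_inj; rewrite ?t0.
Qed.

End AffinePermutations.

Theorem corollary2 (F : fieldType) (p : nat) (charF : p \in [pchar F]%R)
    (V : vectType F) (G : groupClosed (permutation V))
    (G_Aff : forall g : permutation V, g \in G -> in_Aff g)
    (G_abelian : abelian_subgroup G) (G_regular : regular_subgroup G) :
  exists k : nat, is_exponent G (p ^ k).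
Proof.
have pr_p := pcharf_prime charF.
have G_affine : {in G, forall g, affine g}.
  by move=> g /G_Aff/in_Aff_affine.
have [f [fA f_linear_l fixed_eq0 GE]] :=
  abelian_regular_algebra G_affine G_abelian G_regular.
apply: (is_exponent_pfactor (n := \dim {: V}) pr_p) => g Gg.
set q := (p ^ _)%N; have lt_q : (\dim {: V} < q)%N by apply/ltn_expl/prime_gt1.
have G_inj h : h \in G -> h 0 = 0 -> h = 1%g.
  move=> Gh h0; have [k [_ k_uniq]] := G_regular 0 0.
  by rewrite -(k_uniq h) // -(k_uniq 1%g) //; split=> //; exact: gpred1.
apply: G_inj; first exact: gpredXn.
have -> m : (g ^+ m)%g 0 = iter m (fun z => g 0 + z + f (g 0) z) 0.
  by elim: m => // m IHm; rewrite expgSr iterS -IHm -GE.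
rewrite iter_affine_binomial big1 // => i _.
(* All binomials but the last vanish in [F]; the last term is a zero power. *)
have [lt_i | le_q] := ltnP i.+1 q.
  have /dvdnP[c ->] := prime_power_dvd_bin pr_p lt_i.
  by rewrite -scaler_nat natrM (pcharf0 charF) mulr0 scale0r.
rewrite (iter_mul_nilpotent fA) ?mul0rn // => [x|].
  exact: linearP.
by rewrite -ltnS (leq_trans lt_q).
Qed.
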